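(* Consider the problem, over the integers $I_k,R_k$, $$\min_{I_k,R_k}\ R_kL_kI_k-L_k\quad\text{subject to}\quad 1\le I_k\le M_t,\quad 1\le R_k\le M_r,\quad I_k+R_k-1=L_k.$$ With $f(I_k)=L_k(L_k+1-I_k)I_k-L_k$, it reduces to minimizing $f(I_k)$ over $I_k$ subject to $\max\{1,L_k+1-M_r\}\le I_k\le\min\{L_k,M_t\}$. The optimal solution of this problem can be divided into the following four cases: 1. When $M_r<L_k$ and $M_t\ge L_k$, the optimal solution is $I_k=L_k$ (referred to as BS-side DAM). 2. When $M_r\ge L_k$ and $M_t<L_k$, the optimal solution is $I_k=1$ (referred to as UE-side DAM). 3. When $M_r\ge L_k$ and $M_t\ge L_k$, the optimal solution is $I_k=L_k$ or $I_k=1$ (referred to as single-side DAM). 4. When $M_r<L_k$ and $M_t<L_k$: if $f(L_k+1-M_r)\ge f(M_t)$, that is, $M_r(L_k+1-M_r)\ge M_t(L_k+1-M_t)$, the optimal solution is $I_k=M_t$; otherwise it is $I_k=L_k+1-M_r$ (referred to as double-side DAM).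
   Context: Here $k$ is a fixed user index, and $L_k,M_t,M_r\ge 1$ are integers: $M_t$ is the number of base-station (BS) antennas, $M_r$ the number of antennas of the user equipment (UE), and $L_k$ the number of temporally resolvable channel paths of user $k$. In delay alignment modulation (DAM), $I_k$ is the number of delay pre-compensations at the transmitter and $R_k$ the number of delay post-compensations at the receiver. In each case $R_k$ is determined by $R_k=L_k+1-I_k$. The number of desired signal components of user $k$ is taken to be $L_k$, and the objective $R_kL_kI_k-L_k$ is the maximum number of inter-symbol interference signals of user $k$.
   Formalization: In case 4 the problem is assumed to have a feasible point (it has none if M_t+M_r≤L_k, e.g. L_k=5, M_t=M_r=1); and when f(L_k+1-M_r)=f(M_t), I_k=M_t is asserted to be an optimal solution, not necessarily the only one. *)

(* Defs.v *)
From Stdlib Require Import ZArith.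
Open Scope Z_scope.

Definition is_minimizer {T : Type} (S : T -> Prop) (g : T -> Z) (x : T) : Prop :=
  S x /\ forall y : T, S y -> g x <= g y.

(** Points of the two-variable problem are pairs [(I, R)]: [I] delay
    pre-compensations and [R] delay post-compensations. *)
Definition dam_feasible (L Mt Mr : Z) (p : Z * Z) : Prop :=
  let (I, R) := p in
  1 <= I <= Mt /\ 1 <= R <= Mr /\ I + R - 1 = L.

Definition dam_objective (L : Z) (p : Z * Z) : Z :=
  let (I, R) := p in R * L * I - L.

Definition reduced_feasible (L Mt Mr I : Z) : Prop :=
  Z.max 1 (L + 1 - Mr) <= I <= Z.min L Mt.

Definition reduced_objective (L I : Z) : Z :=
  L * (L + 1 - I) * I - L.

Definition dam_optimal (L Mt Mr : Z) : Z * Z -> Prop :=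
  is_minimizer (dam_feasible L Mt Mr) (dam_objective L).

Definition reduced_optimal (L Mt Mr : Z) : Z -> Prop :=
  is_minimizer (reduced_feasible L Mt Mr) (reduced_objective L).

(* Main.v *)
Require Import Defs.
From Stdlib Require Import ZArith Lia.
Open Scope Z_scope.

(** The reduced objective is a concave parabola symmetric about [(L + 1) / 2]:
    [f I - f J = L (J - I) (I + J - (L + 1))]. Hence on an integer interval
    [[a, b]] its minimum sits at the endpoint farther from the axis, i.e. at [b]
    if [L + 1 < a + b], at [a] if [a + b < L + 1], and at both in case of
    equality. *)

Lemma reduced_objective_sub (L I J : Z) :
  reduced_objective L I - reduced_objective L J = L * ((J - I) * (I + J - (L + 1))).
Proof. unfold reduced_objective. ring. Qed.

Lemma reduced_objective_le_iff (L I J : Z) (hL : 1 <= L) :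
  reduced_objective L J <= reduced_objective L I <-> 0 <= (J - I) * (I + J - (L + 1)).
Proof. pose proof (reduced_objective_sub L I J). split; intro; nia. Qed.

Lemma reduced_objective_lt_iff (L I J : Z) (hL : 1 <= L) :
  reduced_objective L J < reduced_objective L I <-> 0 < (J - I) * (I + J - (L + 1)).
Proof. pose proof (reduced_objective_sub L I J). split; intro; nia. Qed.

Lemma minimizer_interval_right (L a b : Z) (hL : 1 <= L) (hab : a <= b)
    (h : reduced_objective L b <= reduced_objective L a) :
  is_minimizer (fun I => a <= I <= b) (reduced_objective L) b.
Proof.
  split; [lia|]. intros y hy.
  apply reduced_objective_le_iff in h; [|lia].
  apply reduced_objective_le_iff; [lia|].
  (* For [y <> b] the interval has [a < b], so the positive factor [b - a] cancels from [h]; if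
     [a = b], then [h] says nothing about [a + b]. *)
  destruct (Z.eq_dec y b) as [->|hne]; [lia|].
  assert (L + 1 <= a + b) by nia. apply Z.mul_nonneg_nonneg; lia.
Qed.

Lemma minimizer_interval_left (L a b : Z) (hL : 1 <= L) (hab : a <= b)
    (h : reduced_objective L a <= reduced_objective L b) :
  is_minimizer (fun I => a <= I <= b) (reduced_objective L) a.
Proof.
  split; [lia|]. intros y hy.
  apply reduced_objective_le_iff in h; [|lia].
  apply reduced_objective_le_iff; [lia|].
  destruct (Z.eq_dec y a) as [->|hne]; [lia|].
  assert (a + b <= L + 1) by nia. apply Z.mul_nonpos_nonpos; lia.
Qed.

Lemma minimizer_interval_right_iff (L a b I : Z) (hL : 1 <= L) (hab : a <= b)
    (h : L + 1 < a + b) :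
  is_minimizer (fun I => a <= I <= b) (reduced_objective L) I <-> I = b.
Proof.
  split.
  (* Comparison with [b] alone suffices: [I + b - (L + 1)] is positive because [a <= I], so [I - b]
     cannot be negative. *)
  - intros [hI hmin]. specialize (hmin b ltac:(lia)).
    apply reduced_objective_le_iff in hmin; nia.
  - intros ->. apply minimizer_interval_right; try lia.
    apply reduced_objective_le_iff; nia.
Qed.

Lemma minimizer_interval_left_iff (L a b I : Z) (hL : 1 <= L) (hab : a <= b)
    (h : a + b < L + 1) :
  is_minimizer (fun I => a <= I <= b) (reduced_objective L) I <-> I = a.
Proof.
  split.
  - intros [hI hmin]. specialize (hmin a ltac:(lia)).
    apply reduced_objective_le_iff in hmin; nia.
  - intros ->. apply minimizer_interval_left; try lia.
    apply reduced_objective_le_iff; nia.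
Qed.

Lemma minimizer_interval_both_iff (L a b I : Z) (hL : 1 <= L) (hab : a <= b)
    (h : a + b = L + 1) :
  is_minimizer (fun I => a <= I <= b) (reduced_objective L) I <-> I = b \/ I = a.
Proof.
  split.
  (* With [a + b = L + 1] the comparison with [b] reads [0 <= (I - b) * (I - a)], which inside the
     interval forces a zero factor. *)
  - intros [hI hmin]. specialize (hmin b ltac:(lia)).
    apply reduced_objective_le_iff in hmin; nia.
  - intros [-> | ->].
    + apply minimizer_interval_right; try lia. apply reduced_objective_le_iff; nia.
    + apply minimizer_interval_left; try lia. apply reduced_objective_le_iff; nia.
Qed.

Lemma dam_feasible_reduced (L Mt Mr I R : Z) :
  dam_feasible L Mt Mr (I, R) <-> R = L + 1 - I /\ reduced_feasible L Mt Mr I.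
Proof. unfold dam_feasible, reduced_feasible. lia. Qed.

Lemma dam_objective_reduced (L I : Z) :
  dam_objective L (I, L + 1 - I) = reduced_objective L I.
Proof. unfold dam_objective, reduced_objective. ring. Qed.

(** The map sending [I] to [(I, L + 1 - I)] is a bijection between the feasible sets that preserves
    the objective. *)
Lemma dam_optimal_reduced (L Mt Mr I R : Z) :
  dam_optimal L Mt Mr (I, R) <-> R = L + 1 - I /\ reduced_optimal L Mt Mr I.
Proof.
  split.
  - intros [hf hmin]. apply dam_feasible_reduced in hf. destruct hf as [-> hf].
    split; [reflexivity|]. split; [exact hf|]. intros J hJ.
    rewrite <- !dam_objective_reduced. apply hmin.
    apply dam_feasible_reduced. now split.
  - intros [-> [hf hmin]]. split; [apply dam_feasible_reduced; now split|].
    intros [J S] hJ. apply dam_feasible_reduced in hJ. destruct hJ as [-> hJ].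
    rewrite !dam_objective_reduced. now apply hmin.
Qed.

Theorem mainTheorem3 (L Mt Mr : Z) (hL : 1 <= L) (hMt : 1 <= Mt) (hMr : 1 <= Mr) :
  (* reduction to the single-variable problem *)
  ((forall I R : Z,
      dam_feasible L Mt Mr (I, R) <-> R = L + 1 - I /\ reduced_feasible L Mt Mr I) /\
   (forall I R : Z,
      dam_feasible L Mt Mr (I, R) -> dam_objective L (I, R) = reduced_objective L I) /\
   (forall I R : Z,
      dam_optimal L Mt Mr (I, R) <-> R = L + 1 - I /\ reduced_optimal L Mt Mr I)) /\
  (* case 1 *)
  (Mr < L -> L <= Mt ->
     forall I : Z, reduced_optimal L Mt Mr I <-> I = L) /\
  (* case 2 *)
  (L <= Mr -> Mt < L ->
     forall I : Z, reduced_optimal L Mt Mr I <-> I = 1) /\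
  (* case 3 *)
  (L <= Mr -> L <= Mt ->
     forall I : Z, reduced_optimal L Mt Mr I <-> I = L \/ I = 1) /\
  (* case 4: the constraints can be inconsistent here, and at equality of the
     two values the minimizer need not be unique *)
  (Mr < L -> Mt < L ->
     (reduced_objective L (L + 1 - Mr) >= reduced_objective L Mt <->
        Mr * (L + 1 - Mr) >= Mt * (L + 1 - Mt)) /\
     ((exists p : Z * Z, dam_feasible L Mt Mr p) ->
        (reduced_objective L (L + 1 - Mr) >= reduced_objective L Mt ->
           reduced_optimal L Mt Mr Mt) /\
        (reduced_objective L (L + 1 - Mr) > reduced_objective L Mt ->
           forall I : Z, reduced_optimal L Mt Mr I <-> I = Mt) /\
        (~ reduced_objective L (L + 1 - Mr) >= reduced_objective L Mt ->
           forall I : Z, reduced_optimal L Mt Mr I <-> I = L + 1 - Mr))).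
Proof.
  unfold reduced_optimal, reduced_feasible.
  split; [split; [|split]|split; [|split; [|split]]].
  - intros I R. apply dam_feasible_reduced.
  - intros I R h. apply dam_feasible_reduced in h. destruct h as [-> _].
    apply dam_objective_reduced.
  - intros I R. apply dam_optimal_reduced.
  (* The interval is [[L + 1 - Mr, L]], whose endpoint sum exceeds [L + 1] since [Mr < L]. In the
     next two cases it is [[1, Mt]] and [[1, L]]. *)
  - intros h1 h2 I. rewrite minimizer_interval_right_iff by lia. lia.
  - intros h1 h2 I. rewrite minimizer_interval_left_iff by lia. lia.
  - intros h1 h2 I. rewrite minimizer_interval_both_iff by lia. lia.
  - intros h1 h2. split.
    { rewrite !Z.ge_le_iff, reduced_objective_le_iff by lia.
      rewrite <- (Z.le_0_sub (Mt * _)).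
      replace (Mr * (L + 1 - Mr) - Mt * (L + 1 - Mt))
        with ((Mt - (L + 1 - Mr)) * (L + 1 - Mr + Mt - (L + 1))) by ring.
      reflexivity. }
    (* The feasible point yields [L + 1 - Mr <= Mt], so the interval [[L + 1 - Mr, Mt]] is
       nonempty. *)
    intros [[I0 R0] h0]. unfold dam_feasible in h0.
    rewrite Z.max_r, Z.min_r by lia.
    split; [|split].
    + intro h. apply minimizer_interval_right; lia.
    + intros h I. apply minimizer_interval_right_iff; try lia.
      (* A strict gap between the endpoint values makes the product positive, which fixes the side
         of [L + 1] on which the endpoint sum lies. *)
      apply Z.gt_lt, reduced_objective_lt_iff in h; nia.
    + intros h I. apply minimizer_interval_left_iff; try lia.
      rewrite Z.ge_le_iff, Z.nle_gt, reduced_objective_lt_iff in h by lia. nia.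
Qed.
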